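(* Let $(\mathcal{A},Q)$ be an almost commutative $Q$-algebra of degree $1$ (with respect to an abelian group $G$ and cocycle $\rho$), and let $[\![-,-]\!]_Q$ and $\mathrm{a}_Q$ denote the associated derived $\rho$-antibracket and anchor map. Then the derived $\rho$-antibracket and anchor map are compatible in the sense that $$\mathrm{a}_Q\big([\![\sigma,\psi]\!]_Q\big)=\big[\mathrm{a}_Q(\sigma),\mathrm{a}_Q(\psi)\big]_\rho$$ for all $\sigma,\psi\in\mathrm{Sec}(\mathcal{A})$.
   Context: Let $\mathbb{K}=\mathbb{R}$ or $\mathbb{C}$ and let $G$ be an abelian group written additively. A cocycle is a map $\rho:G\times G\to\mathbb{K}$ with $\rho(a,b)=\rho(b,a)^{-1}$ and $\rho(a+b,c)=\rho(a,c)\rho(b,c)$ for all $a,b,c\in G$. For a $G$-graded associative $\mathbb{K}$-algebra, $|f|\in G$ denotes the degree of a homogeneous element $f$ and the $\rho$-commutator is $[f,g]_\rho := fg-\rho(|f|,|g|)\,gf$ (extended linearly; all formulas are for homogeneous elements and extended by linearity). The algebra is $\rho$-commutative (almost commutative) if $[f,g]_\rho=0$ for all $f,g$. The same formula defines the $\rho$-commutator of homogeneous linear maps. An almost commutative non-negatively graded algebra is an $(\mathbb{N},G)$-bigraded algebra $\mathcal{A}=\bigoplus_{i\in\mathbb{N},a\in G}\mathcal{A}_{(i,a)}$ (with $\mathcal{A}_{(i,a)}\cdot\mathcal{A}_{(j,b)}\subset\mathcal{A}_{(i+j,a+b)}$, $0\in\mathbb{N}$) that is $\rho$-commutative with respect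 to the $G$-degree; the $\mathbb{N}$-degree is called weight and plays no role in the commutation rule. Put $\mathcal{A}_i:=\bigoplus_{a}\mathcal{A}_{(i,a)}$, let $\mathrm{Alg}(\mathcal{A}_i)$ be the subalgebra generated by $\mathcal{A}_0\oplus\cdots\oplus\mathcal{A}_i$, and $\mathcal{A}_{\langle i\rangle}:=\mathrm{Alg}(\mathcal{A}_{i-1})\cap\mathcal{A}_i$. $\mathcal{A}$ is of degree $n$ if $\mathcal{A}_i/\mathcal{A}_{\langle i\rangle}=\{0\}$ for all $i>n$ (by convention $n$ is the least such integer). A $\rho$-derivation of a $G$-graded algebra $\mathcal{A}$ of $G$-degree $|X|$ is a linear map $X:\mathcal{A}\to\mathcal{A}$ of $G$-degree $|X|$ with $X(fg)=(Xf)g+\rho(|X|,|f|)\,f(Xg)$. $\rho\mathrm{Der}(\mathcal{A})$ is the $G$-graded vector space of all $\rho$-derivations; it is closed under $[-,-]_\rho$, and for $\mathcal{A}$ almost commutative it is a left $\mathcal{A}$-module via $(fX)g=f(Xg)$. For bigraded $\mathcal{A}$ it is also $\mathbb{Z}$-graded by weight: $\rho\mathrm{Der}_i(\mathcal{A})$ consists of the $\rho$-derivations that shift weight by $i$. A homological $\rho$-derivation is a homogeneous $Q\in\rho\mathrm{Der}(\mathcal{A})$ with $\rho(|Q|,|Q|)=-1$ and $[Q,Q]_\rho=0$. An almost commutative $Q$-algebra of degree $1$ is a pair $(\mathcal{A},Q)$ with $\mathcal{A}$ an almost commutative non-negatively graded algebra of degree one and $Q$ a homological $\rho$-derivation of $\mathcal{A}$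 of weight ($\mathbb{Z}$-degree) $1$. Put $\mathcal{B}:=\bigoplus_{a\in G}\mathcal{A}_{(0,a)}$, a $\rho$-commutative algebra. The sections are $\mathrm{Sec}(\mathcal{A}):=\rho\mathrm{Der}_-(\mathcal{A})$, the $\rho$-derivations of negative weight (which here all have weight $-1$), graded by $G$-degree; this is a left $\mathcal{B}$-module. The derived $\rho$-antibracket is the bilinear map $\mathrm{Sec}(\mathcal{A})\times\mathrm{Sec}(\mathcal{A})\to\mathrm{Sec}(\mathcal{A})$, $[\![\sigma,\psi]\!]_Q:=\rho(|\sigma|+|Q|,|Q|)\,[[Q,\sigma]_\rho,\psi]_\rho$. The anchor map is the morphism of left $\mathcal{B}$-modules $\mathrm{a}_Q:\mathrm{Sec}(\mathcal{A})\to\rho\mathrm{Der}(\mathcal{B})$ defined by $\mathrm{a}_Q(\sigma)f:=\rho(|\sigma|+|Q|,|Q|)\,[Q,\sigma]_\rho(f)=\sigma(Q(f))$ for $f\in\mathcal{B}$; thus $\mathrm{a}_Q(\sigma)$ has $G$-degree $|\sigma|+|Q|$. *)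

(* Defs.v *)
From HB Require Import structures.
From mathcomp Require Import all_boot all_order all_algebra.
From mathcomp Require Import sesquilinear finmap.
From mathcomp Require Import boolp classical_sets functions cardinality fsbigop.
From mathcomp Require Import reals.
From mathcomp Require Import complex.

Set Implicit Arguments.
Unset Strict Implicit.
Unset Printing Implicit Defensive.

Import Order.TTheory GRing.Theory Num.Theory.

Local Open Scope classical_set_scope.
Local Open Scope ring_scope.

Variant ground_field := RealNumbers | ComplexNumbers.

Definition scalars (R : realType) (k : ground_field) : numFieldType :=
  match k with
  | RealNumbers => R
  | ComplexNumbers => R[i]
  end.

(* Since 0^-1 = 0 in MathComp, [cocycle_sym] alone would allow rho = 0; the
   implicit invertibility of the values is [cocycle_neq0]. *)
Record cocycle (K : fieldType) (G : zmodType) := Cocycle {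
  cocycle_fun :> G -> G -> K;
  cocycle_neq0 : forall a b, cocycle_fun a b != 0;
  cocycle_sym : forall a b, cocycle_fun a b = (cocycle_fun b a)^-1;
  cocycleD : forall a b c,
    cocycle_fun (a + b) c = cocycle_fun a c * cocycle_fun b c }.

Section DirectSums.
Variables (K : fieldType) (V : lmodType K) (I : choiceType).
Implicit Types (S : I -> set V) (v : V).

Definition linear_subspace (W : set V) : Prop :=
  W 0 /\ forall (c : K) u v, W u -> W v -> W (c *: u + v).

Definition decomposition S v : set (I -> V) :=
  [set F | [/\ forall i, S i (F i), finite_set [set i | F i <> 0]
             & v = \sum_(i \in [set: I]) F i]].

Definition grading S : Prop :=
  (forall i, linear_subspace (S i)) /\
  forall v, exists! F, decomposition S v F.

(* The sum of the [S i]; it is only used for independent families. *)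
Definition dirsum S : set V := [set v | exists F, decomposition S v F].

(* The [S i]-component of v, for v in the direct sum of the [S i]. *)
Definition component S i v : V := xget (fun=> 0) (decomposition S v) i.

End DirectSums.

(* Families of maps V -> V are graded through the pointwise K-module structure
   on functions, so that [decomposition], [component], etc. apply to them. *)
Section GradedMaps.
Variables (K : fieldType) (G : zmodType) (rho : cocycle K G).

(* The rho-commutator of a graded K-module W with product mul (used both for
   algebras and for composition of maps), extended bilinearly. *)
Definition rho_bracket (W : lmodType K) (mul : W -> W -> W)
    (S : G -> set W) (f g : W) : W :=
  \sum_(a \in [set: G]) \sum_(b \in [set: G])
    (mul (component S a f) (component S b g)
     - rho a b *: mul (component S b g) (component S a f)).

Definition hom_deg (V : lmodType K) (S : G -> set V) (a : G) : set (V -> V) :=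
  [set X | linear X /\ forall b v, S b v -> S (a + b) (X v)].

Definition rho_comm_maps (V : lmodType K) (S : G -> set V)
    (X Y : V -> V) : V -> V :=
  rho_bracket (fun X Y : V -> V => X \o Y) (hom_deg S) X Y.

End GradedMaps.

(* Algebras are not assumed to be unital, so MathComp's algType is too narrow. *)
Record assoc_alg (K : fieldType) := AssocAlg {
  alg_sort :> lmodType K;
  alg_mul : alg_sort -> alg_sort -> alg_sort;
  alg_bilinear : bilinear_for *:%R *:%R alg_mul;
  alg_mulA : associative alg_mul }.

Section Derivations.
Variables (K : fieldType) (G : zmodType) (rho : cocycle K G).
Variables (A : assoc_alg K) (S : G -> set A).

Definition rhoDer_deg (a : G) : set (A -> A) :=
  [set X | hom_deg S a X /\
    forall b f g, S b f ->
      X (alg_mul f g) = alg_mul (X f) g + rho a b *: alg_mul f (X g)].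

Definition rhoDer : set (A -> A) := dirsum rhoDer_deg.

End Derivations.

Record ac_alg (K : fieldType) (G : zmodType) (rho : cocycle K G) := ACAlg {
  ac_assoc :> assoc_alg K;
  bihom : nat -> G -> set ac_assoc;
  bihom_grading : grading (fun p : nat * G => bihom p.1 p.2);
  bihomM : forall i j a b f g, bihom i a f -> bihom j b g ->
    bihom (i + j)%N (a + b) (alg_mul f g);
  ac_rho_comm : forall f g,
    rho_bracket rho (@alg_mul K ac_assoc)
      (fun a => dirsum (fun i => bihom i a)) f g = 0 }.

Arguments bihom {K G rho} _ _ _.

Section AlmostCommutativeAlgebras.
Variables (K : fieldType) (G : zmodType) (rho : cocycle K G).
Variable A : ac_alg rho.

Definition Gdeg (a : G) : set A := dirsum (fun i : nat => bihom A i a).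

Definition weight (i : int) : set A :=
  if i is Posz n then dirsum (fun a : G => bihom A n a) else [set 0].

Definition subalgebra (M : set A) : Prop :=
  linear_subspace M /\ forall f g, M f -> M g -> M (alg_mul f g).

Definition Alg (i : nat) : set A :=
  smallest subalgebra (dirsum (fun j : 'I_i.+1 => weight j)).

(* This is A_<i>, for i > 0. *)
Definition decomposable (i : nat) : set A := Alg i.-1 `&` weight i.

(* The vanishing of the quotient of weight i by decomposable i is written as
   an equality of subspaces. *)
Definition degree_at_most (n : nat) : Prop :=
  forall i : nat, (n < i)%N -> decomposable i = weight i.

Definition has_degree (n : nat) : Prop :=
  degree_at_most n /\ forall m, degree_at_most m -> (n <= m)%N.

Definition rhoDer_wt (i : int) : set (A -> A) :=
  [set X | rhoDer rho Gdeg X /\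
    forall (j : nat) f, weight j f -> weight (j%:Z + i) (X f)].

(* Negz n is -(n+1). *)
Definition Sec : set (A -> A) := dirsum (fun n : nat => rhoDer_wt (Negz n)).

Definition homological (q : G) (Q : A -> A) : Prop :=
  [/\ rhoDer_deg rho Gdeg q Q, rho q q = -1
    & rho_comm_maps rho Gdeg Q Q = 0].

End AlmostCommutativeAlgebras.

Arguments Gdeg {K G rho} A _.
Arguments weight {K G rho} A _.
Arguments rhoDer_wt {K G rho} A _.
Arguments Sec {K G rho} A.
Arguments homological {K G rho} A _ _.

Record Qalg1 (K : fieldType) (G : zmodType) (rho : cocycle K G) := QAlg1 {
  qalg :> ac_alg rho;
  qalg_deg : has_degree qalg 1%N;
  Qdeg : G;
  Qder : qalg -> qalg;
  Qder_homological : homological qalg Qdeg Qder;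
  Qder_weight : rhoDer_wt qalg 1 Qder }.

Arguments Qdeg {K G rho} _.
Arguments Qder {K G rho} _.

Section DirectSumTheory.
Variables (K : fieldType) (V : lmodType K).
Implicit Types (I : choiceType).

Lemma linear_subspace_sum (W : set V) I (r : seq I) (F : I -> V) :
  linear_subspace W -> (forall i, W (F i)) -> W (\sum_(i <- r) F i).
Proof.
move=> [W0 WP] WF; elim: r => [|i r IH]; first by rewrite big_nil.
by rewrite big_cons -[F i]scale1r; exact: WP.
Qed.

Lemma linear_subspace_fsum (W : set V) I (F : I -> V) :
  linear_subspace W -> (forall i, W (F i)) -> W (\sum_(i \in [set: I]) F i).
Proof. by move=> WW WF; exact: linear_subspace_sum. Qed.

Lemma linear_subspaceZ (W : set V) c v :
  linear_subspace W -> W v -> W (c *: v).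
Proof. by move=> [W0 WP] Wv; rewrite -[c *: v]addr0; exact: WP. Qed.

Lemma dirsumP I (S : I -> set V) v : dirsum S v ->
  exists (F : I -> V) (r : seq I),
    (forall i, S i (F i)) /\ v = \sum_(i <- r) F i.
Proof.
move=> [F [SF finF vE]]; exists F, (fset_set [set i | F i <> 0]).
split=> //; rewrite vE; apply: fsbigTE => i; rewrite in_fset_set// notin_setE/=.
exact: contrapT.
Qed.

Lemma linear_subspace_dirsum I (S : I -> set V) :
  (forall i, linear_subspace (S i)) -> linear_subspace (dirsum S).
Proof.
move=> SS; split.
  exists (fun=> 0); split => [i||]; first by case: (SS i).
    by apply: (sub_finite_set _ (finite_set0 I)) => i /=.
  by rewrite fsbig1.
move=> c u v [F [SF finF ->]] [H [SH finH ->]].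
exists (fun i => c *: F i + H i); split => [i||].
- by case: (SS i) => _; apply.
- have finU : finite_set ([set i | F i <> 0] `|` [set i | H i <> 0]).
    by rewrite finite_setU.
  apply: sub_finite_set finU => i /= FH0; apply: contrapT => /not_orP[].
  by move=> /contrapT F0 /contrapT H0; apply: FH0; rewrite F0 H0 scaler0 addr0.
- pose r := (fset_set ([set i | F i <> 0] `|` [set i | H i <> 0])).
  have finU : finite_set ([set i | F i <> 0] `|` [set i | H i <> 0]).
    by rewrite finite_setU.
  have out i : i \notin r -> F i = 0 /\ H i = 0.
    by rewrite in_fset_set// notin_setE/= => /not_orP[/contrapT ? /contrapT ?].
  rewrite (fsbigTE r) => [|i /out[]//]; rewrite (fsbigTE r) => [|i /out[]//].
  rewrite (fsbigTE r) => [|i /out[-> ->]]; last by rewrite scaler0 addr0.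
  by rewrite scaler_sumr -big_split.
Qed.

Lemma fsumTE I (Q : set I) (F : I -> V) :
  finite_set Q -> (forall i, F i <> 0 -> Q i) ->
  \sum_(i \in [set: I]) F i = \sum_(i \in Q) F i.
Proof.
move=> finQ FQ; rewrite [RHS]fsbig_finite// [RHS]/=; apply: fsbigTE => i.
by rewrite in_fset_set// notin_setE => NQ; apply: contrapT => /FQ.
Qed.

Definition independent I (S : I -> set V) : Prop :=
  forall v F H, decomposition S v F -> decomposition S v H -> F = H.

Lemma grading_independent I (S : I -> set V) : grading S -> independent S.
Proof.
by move=> [_ Sv] v F H SF SH; case: (Sv v) => F0 [_ u]; rewrite -(u _ SF) (u _ SH).
Qed.

Lemma componentE I (S : I -> set V) v F : independent S ->
  decomposition S v F -> forall i, component S i v = F i.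
Proof.
move=> indS SF i; rewrite /component.
by rewrite (xget_unique _ SF) // => H SH; exact: indS SH SF.
Qed.

Lemma decomposition1 I (S : I -> set V) i v :
  (forall i, linear_subspace (S i)) -> S i v ->
  decomposition S v (fun j => if j == i then v else 0).
Proof.
move=> SS Siv; split.
- by move=> j; case: eqVneq => [->//|_]; case: (SS j).
- apply: (sub_finite_set _ (finite_set1 i)) => j /=.
  by case: eqVneq => // _ /(_ erefl).
- rewrite (fsbigTE [fset i]%fset) => [|j]; last by rewrite in_fset1 => /negbTE->.
  by rewrite big_seq_fset1 eqxx.
Qed.

Lemma dirsum_in I (S : I -> set V) i v :
  (forall i, linear_subspace (S i)) -> S i v -> dirsum S v.
Proof. by move=> SS /(decomposition1 SS) dv; eexists; exact: dv. Qed.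

Lemma independent_regroup I (J : choiceType) (S : I -> J -> set V) :
  (forall i j, linear_subspace (S i j)) ->
  independent (fun p : I * J => S p.1 p.2) ->
  independent (fun j => dirsum (fun i => S i j)).
Proof.
move=> SS indS v.
have refine H : decomposition (fun j => dirsum (fun i => S i j)) v H ->
    exists2 F : I * J -> V, decomposition (fun p : I * J => S p.1 p.2) v F
    & forall j, H j = \sum_(i \in [set: I]) F (i, j).
  move=> [SH finH vE].
  have [F0 F0P] := choice SH.
  pose F (p : I * J) := if H p.2 == 0 then 0 else F0 p.2 p.1.
  have FE j : H j = \sum_(i \in [set: I]) F (i, j).
    rewrite /F /=; case: eqVneq => [->|_]; first by rewrite fsbig1.
    by case: (F0P j).
  exists F => //.
  pose Q := \bigcup_(j in [set j | H j <> 0]) [set i | F0 j i <> 0].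
  have finQ : finite_set Q by apply: bigcup_finite => // j _; case: (F0P j).
  have FQ i j : F (i, j) <> 0 -> Q i /\ H j <> 0.
    by rewrite /F /=; case: eqVneq => // /eqP Hj0 Fij; split=> //; exists j.
  have finQH : finite_set (Q `*` [set j | H j <> 0]) by exact: finite_setX.
  split.
  - move=> [i j]; rewrite /F /=; case: eqVneq => _; first by case: (SS i j).
    by case: (F0P j).
  - by apply: sub_finite_set finQH => -[i j] /= /FQ.
  - rewrite vE (fsumTE (Q := [set j | H j <> 0]))//.
    under eq_fsbigr => j _.
      by rewrite FE (fsumTE (Q := Q)) => [|//|i /FQ[]//]; over.
    rewrite exchange_fsbig// pair_fsbig//.
    rewrite [RHS](fsumTE (Q := Q `*` [set j | H j <> 0]))//.
    by move=> [i j] /FQ.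
move=> H H' /refine[F SF HE] /refine[F' SF' HE'].
apply/funext => j; rewrite HE HE'; have -> // := indS _ _ _ SF SF'.
Qed.

End DirectSumTheory.

Section GradedMapsTheory.
Variables (K : fieldType) (G : zmodType) (V : lmodType K) (S : G -> set V).
Hypothesis SS : forall a, linear_subspace (S a).
Hypothesis indS : independent S.

Lemma linear_subspace_hom_deg a : linear_subspace (hom_deg S a).
Proof.
split.
  split; first by move=> c u v; rewrite /= scaler0 addr0.
  by move=> b v _; case: (SS (a + b)).
move=> c X Y [linX SX] [linY SY]; split.
  move=> d u v; rewrite !fctE linX linY !scalerDr !scalerA [c * d]mulrC.
  by rewrite addrACA.
by move=> b v Sv; rewrite !fctE; case: (SS (a + b)) => _; apply; auto.
Qed.

Lemma decomposition_eval X (F : G -> V -> V) b v :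
  decomposition (hom_deg S) X F -> S b v ->
  decomposition S (X v) (fun c => F (c - b) v).
Proof.
move=> [SF finF ->] Sv; split.
- by move=> c; case: (SF (c - b)) => _ /(_ b v Sv); rewrite subrK.
- apply: sub_finite_set (finite_image (fun a => a + b) finF) => c /= Fc0.
  by exists (c - b); rewrite ?subrK// => F0; apply: Fc0; rewrite F0.
- pose r := fset_set [set i | F i <> 0].
  have out a : a \notin r -> F a = 0.
    by rewrite in_fset_set// notin_setE/= => /contrapT.
  rewrite (fsbigTE r)// fct_sumE.
  rewrite (reindex_fsbigT (fun a => a + b)); last first.
    by exists (fun a => a - b) => a; rewrite ?addrK ?subrK.
  rewrite (fsbigTE r) => [|a /out]; last by rewrite addrK => ->.
  by apply: eq_bigr => a _; rewrite addrK.
Qed.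

Lemma independent_hom_deg : dirsum S = setT -> independent (hom_deg S).
Proof.
move=> fullS X F H dF dH; apply/funext => a; apply/funext => v.
have [E [r [SE ->]]] : exists E r, (forall b, S b (E b)) /\ v = \sum_(b <- r) E b.
  by apply: dirsumP; rewrite fullS.
have FH b : F a (E b) = H a (E b).
  have := indS (decomposition_eval dF (SE b)) (decomposition_eval dH (SE b)).
  by move=> /(congr1 (fun f => f (a + b))); rewrite !addrK.
have [linF _] : hom_deg S a (F a) by case: dF.
have [linH _] : hom_deg S a (H a) by case: dH.
have lin_sum (L : V -> V) : linear L -> L (\sum_(b <- r) E b) = \sum_(b <- r) L (E b).
  move=> linL; elim: (r) => [|b s IH]; last first.
    by rewrite !big_cons -[E b in LHS]scale1r linL IH scale1r.
  by have := linL (-1) 0 0; rewrite !big_nil scaler0 addr0 scaleN1r addNr.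
by rewrite !lin_sum//; apply: eq_bigr => b _.
Qed.

Lemma rho_comm_mapsE (rho : cocycle K G) a b X Y : dirsum S = setT ->
  hom_deg S a X -> hom_deg S b Y ->
  rho_comm_maps rho S X Y = X \o Y - rho a b *: (Y \o X).
Proof.
move=> fullS SX SY; have ind := independent_hom_deg fullS.
have SSh := linear_subspace_hom_deg.
have X0 : X 0 = 0 by case: SX => linX _; have := linX (-1) 0 0;
  rewrite scaler0 addr0 scaleN1r addNr.
have Y0 : Y 0 = 0 by case: SY => linY _; have := linY (-1) 0 0;
  rewrite scaler0 addr0 scaleN1r addNr.
have comp0l (Z : V -> V) : (0 : V -> V) \o Z = 0 by [].
have compX0 : X \o (0 : V -> V) = 0 by apply/funext => v; exact: X0.
have compY0 : Y \o (0 : V -> V) = 0 by apply/funext => v; exact: Y0.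
have XE := componentE ind (decomposition1 SSh SX).
have YE := componentE ind (decomposition1 SSh SY).
rewrite /rho_comm_maps /rho_bracket (fsbigTE [fset a]%fset) => [|c]; last first.
  rewrite in_fset1 => /negbTE ca; apply: fsbig1 => d _; rewrite XE YE ca comp0l.
  by case: ifP => _; rewrite ?compY0 ?comp0l scaler0 subr0.
rewrite big_seq_fset1 (fsbigTE [fset b]%fset) => [|d]; last first.
  rewrite in_fset1 => /negbTE db; rewrite XE YE db eqxx.
  by rewrite compX0 comp0l scaler0 subr0.
by rewrite big_seq_fset1 XE YE !eqxx.
Qed.

End GradedMapsTheory.

Section Base.
Variables (K : fieldType) (G : zmodType) (rho : cocycle K G) (A : ac_alg rho).

Lemma linear_subspace_bihom i a : linear_subspace (bihom A i a).
Proof. by case: (bihom_grading A) => /(_ (i, a)). Qed.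

Lemma linear_subspace_weight i : linear_subspace (weight A i).
Proof.
case: i => n; first by apply: linear_subspace_dirsum => a; exact: linear_subspace_bihom.
by split=> // c u v -> ->; rewrite scaler0 addr0.
Qed.

Definition in_base : pred A := fun f => `[< weight A 0 f >].

Lemma in_base_closed : submod_closed in_base.
Proof.
have [W0 WP] := linear_subspace_weight 0.
split; first exact/asboolP.
by move=> c u v /asboolP Wu /asboolP Wv; apply/asboolP; exact: WP.
Qed.

HB.instance Definition _ := GRing.isSubmodClosed.Build K A in_base in_base_closed.

Definition base := {f : A | in_base f}.

HB.instance Definition _ := SubChoice.on base.
HB.instance Definition _ := [SubChoice_isSubLmodule of base by <:].

Lemma alg_mul_suml (B : assoc_alg K) (I : Type) (r : seq I) (F : I -> B) g :
  alg_mul (\sum_(i <- r) F i) g = \sum_(i <- r) alg_mul (F i) g.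
Proof.
have [bil _] := @alg_bilinear _ B.
elim: r => [|i r IH]; last first.
  by have /= := bil g 1 (F i) (\sum_(j <- r) F j); rewrite !big_cons !scale1r IH.
by have /= := bil g (-1) 0 0; rewrite !big_nil scaler0 addr0 scaleN1r addNr.
Qed.

Lemma alg_mul_sumr (B : assoc_alg K) (I : Type) (r : seq I) (F : I -> B) f :
  alg_mul f (\sum_(i <- r) F i) = \sum_(i <- r) alg_mul f (F i).
Proof.
have [_ bil] := @alg_bilinear _ B.
elim: r => [|i r IH]; last first.
  by have /= := bil f 1 (F i) (\sum_(j <- r) F j); rewrite !big_cons !scale1r IH.
by have /= := bil f (-1) 0 0; rewrite !big_nil scaler0 addr0 scaleN1r addNr.
Qed.

Lemma weight0M (f g : A) : weight A 0 f -> weight A 0 g -> weight A 0 (alg_mul f g).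
Proof.
move=> /dirsumP[F [r [SF ->]]] /dirsumP[H [s [SH ->]]].
have SW := linear_subspace_weight 0.
rewrite alg_mul_suml; apply: linear_subspace_sum => // a.
rewrite alg_mul_sumr; apply: linear_subspace_sum => // b.
apply: (@dirsum_in _ _ _ _ (a + b)) => [c|]; first exact: linear_subspace_bihom.
exact: (bihomM (SF a) (SH b)).
Qed.

Fact base_mul_subproof (f g : base) : in_base (alg_mul (val f) (val g)).
Proof. by apply/asboolP/weight0M; apply/asboolP; [exact: (valP f)|exact: (valP g)]. Qed.

Definition base_mul (f g : base) : base := Sub _ (base_mul_subproof f g).

Fact base_mul_bilinear : bilinear_for *:%R *:%R base_mul.
Proof.
have [bill bilr] := @alg_bilinear _ A.
split=> u c f g; apply/val_inj; rewrite /=.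
  exact: bill.
exact: bilr.
Qed.

Fact base_mulA : associative base_mul.
Proof. by move=> f g h; apply: val_inj; rewrite !SubK alg_mulA. Qed.

Definition base_alg : assoc_alg K := AssocAlg base_mul_bilinear base_mulA.

Definition base_deg (a : G) : set base_alg :=
  [set f : base | bihom A 0 a (val f)].

End Base.

Section DerivedBracket.
Variables (K : fieldType) (G : zmodType) (rho : cocycle K G) (A : Qalg1 rho).

Local Notation q := (Qdeg A).
Local Notation Q := (Qder A).
Local Notation Gdeg := (Gdeg A).
Local Notation bracket := (rho_comm_maps rho Gdeg).
Local Notation part := (component (hom_deg Gdeg)).

Definition antibracket (s p : A -> A) : A -> A :=
  \sum_(a \in [set: G]) rho (a + q) q *: bracket (bracket Q (part a s)) p.

(* [insubd 0] only corestricts to the base: for s in Sec the map below does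
   send the base to itself, see [anchorE]. *)
Definition anchor (s : A -> A) : base_alg A -> base_alg A := fun f =>
  insubd (0 : base A) ((\sum_(a \in [set: G]) rho (a + q) q *: bracket Q (part a s)) (val f)).

Lemma linear_subspace_Gdeg a : linear_subspace (Gdeg a).
Proof. by apply: linear_subspace_dirsum => i; exact: linear_subspace_bihom. Qed.

Lemma independent_Gdeg : independent Gdeg.
Proof.
apply: independent_regroup; first by move=> i a; exact: linear_subspace_bihom.
exact: grading_independent (bihom_grading A).
Qed.

Lemma bihom_Gdeg i a f : bihom A i a f -> Gdeg a f.
Proof.
by apply: (dirsum_in (S := fun i => bihom A i a)) => j; exact: linear_subspace_bihom.
Qed.

Lemma dirsum_Gdeg : dirsum Gdeg = setT.
Proof.
rewrite -subTset => f _; have [_ /(_ f)[F [/(ex_intro _ F) dF _]]] := bihom_grading A.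
have [{}F [r [SF ->]]] := dirsumP dF.
apply: linear_subspace_sum => [|p].
  by apply: linear_subspace_dirsum; exact: linear_subspace_Gdeg.
by apply: (dirsum_in linear_subspace_Gdeg); exact: bihom_Gdeg (SF p).
Qed.

Lemma linear_subspace_rhoDer_deg a : linear_subspace (rhoDer_deg rho Gdeg a).
Proof.
have SH := linear_subspace_hom_deg linear_subspace_Gdeg a.
have [bill bilr] := @alg_bilinear _ A.
split.
  split; first by case: SH.
  move=> b f g _; have /= := bill g (-1) 0 0; have /= := bilr f (-1) 0 0.
  rewrite !scaler0 !addr0 !scaleN1r !addNr => mf0 m0g.
  change (0 = alg_mul 0 g + rho a b *: alg_mul f 0 :> A).
  by rewrite mf0 m0g scaler0 addr0.
move=> c X Y [hX dX] [hY dY]; split; first by case: SH => _; apply.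
move=> b f g Sf; rewrite !fctE (dX _ _ _ Sf) (dY _ _ _ Sf).
have /= -> := bill g c (X f) (Y f); have /= -> := bilr f c (X g) (Y g).
by rewrite !scalerDr !scalerA [c * _]mulrC addrACA.
Qed.

Lemma Sec_part s : Sec A s -> decomposition (rhoDer_deg rho Gdeg) s (part^~ s).
Proof.
move=> /dirsumP[D [r [SD ->]]].
have [F dF] : dirsum (rhoDer_deg rho Gdeg) (\sum_(i <- r) D i).
  apply: linear_subspace_sum => [|i]; last by case: (SD i).
  by apply: linear_subspace_dirsum; exact: linear_subspace_rhoDer_deg.
have dF' : decomposition (hom_deg Gdeg) (\sum_(i <- r) D i) F.
  by case: dF => SF fF ->; split=> // a; case: (SF a).
suff -> : part^~ (\sum_(i <- r) D i) = F by [].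
apply/funext => a; apply: componentE dF' _.
exact: independent_hom_deg independent_Gdeg dirsum_Gdeg.
Qed.

Lemma Sec_weight0 s f : Sec A s -> weight A 0 f -> s f = 0.
Proof.
move=> /dirsumP[D [r [SD ->]]] Wf; rewrite fct_sumE big1// => n _.
by case: (SD n) => _ /(_ 0%N f Wf); rewrite add0r.
Qed.

Lemma Sec_weight1 s f : Sec A s -> weight A 1 f -> weight A 0 (s f).
Proof.
move=> /dirsumP[D [r [SD ->]]] Wf; rewrite fct_sumE.
have W0 := linear_subspace_weight A 0.
apply: linear_subspace_sum => // n.
by case: (SD n) => _ /(_ 1%N f Wf); case: (n) => [//|m /= ->]; case: W0.
Qed.

Lemma part_weight0 s a f : Sec A s -> weight A 0 f -> part a s f = 0.
Proof.
move=> Ss /dirsumP[E [r [SE ->]]].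
have [hF fF sE] := Sec_part Ss.
have dF : decomposition (hom_deg Gdeg) s (part^~ s).
  by split=> // b; case: (hF b).
have [[linp _] _] := hF a.
have p0 : part a s 0 = 0.
  by have := linp (-1) 0 0; rewrite scaler0 addr0 scaleN1r addNr.
have pE b : part a s (E b) = 0.
  have d := decomposition_eval dF (bihom_Gdeg (SE b)).
  have W : weight A 0 (E b).
    apply: (dirsum_in (S := bihom A 0)) (SE b) => c.
    exact: linear_subspace_bihom.
  rewrite (Sec_weight0 Ss W) in d.
  have d0 := decomposition1 linear_subspace_Gdeg (proj1 (linear_subspace_Gdeg 0)).
  have := independent_Gdeg d d0.
  by move=> /(congr1 (fun f => f (a + b))); rewrite addrK if_same.
elim: r => [|b r IH]; first by rewrite big_nil.
by rewrite big_cons -[E b]scale1r linp pE IH scaler0 addr0.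
Qed.

Lemma anchorE s (f : base_alg A) : Sec A s -> val (anchor s f) = s (Q (val f)).
Proof.
move=> Ss; have Wf : weight A 0 (val f) by apply/asboolP; exact: (valP f).
have W1 : weight A 1 (Q (val f)).
  by case: (Qder_weight A) => _ /(_ 0%N _ Wf).
have [[hQ _] qq _] := Qder_homological A.
suff E : (\sum_(a \in [set: G]) rho (a + q) q *: bracket Q (part a s)) (val f)
    = s (Q (val f)).
  rewrite /anchor insubdK E//; apply/asboolP; exact: Sec_weight1.
have [hF fF sE] := Sec_part Ss.
have Q0 : Q 0 = 0.
  by case: hQ => linQ _; have := linQ (-1) 0 0; rewrite scaler0 addr0 scaleN1r addNr.
have bE a : bracket Q (part a s) = Q \o part a s - rho q a *: (part a s \o Q).
  apply: rho_comm_mapsE => //; [exact: linear_subspace_Gdeg |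
    exact: independent_Gdeg | exact: dirsum_Gdeg | by case: (hF a)].
pose r := fset_set [set a | part a s <> 0].
have out a : a \notin r -> part a s = 0.
  by rewrite in_fset_set// notin_setE/= => /contrapT.
rewrite (fsbigTE r) => [|a /out pa]; last first.
  rewrite bE pa; apply/funext => v.
  by rewrite !fctE /= Q0 !scaler0 subr0 scaler0.
rewrite [in RHS]sE (fsbigTE r)// !fct_sumE; apply: eq_bigr => a _.
rewrite bE !fctE /= (part_weight0 _ Ss Wf) Q0 sub0r scalerN scalerA cocycleD qq.
rewrite (cocycle_sym rho a q) mulrN1 mulNr mulVf ?cocycle_neq0//.
by rewrite scaleN1r opprK.
Qed.

End DerivedBracket.

(* Main.v *)
Require Import Defs.
From mathcomp Require Import all_boot all_order all_algebra.
From mathcomp Require Import finmap.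
From mathcomp Require Import boolp classical_sets functions cardinality fsbigop reals.

(** Split both sections into their G-homogeneous components, s = sum s_a and
    p = sum p_b, and write q for the degree of Q.  Everything rests on three
    facts: a section kills weight 0, it sends weight 1 to weight 0, and
    Q (Q f) = 0, since [Q, Q] = 2 Q Q when rho(q, q) = -1.

    For f of weight 0 the element p_b (Q f) has weight 0, so s_a kills it.  In
    [[Q, s_a], p_b] (Q f) only the terms s_a Q p_b Q f and p_b Q s_a Q f
    survive: the others contain Q Q f or s_a p_b Q f.  The signs are
    rho(a+q, q) rho(q, a) = -1 and
    rho(a+q, q) rho(q+a, b) = rho(a+q, b+q), so that
<<
      rho(a+q, q) [[Q, s_a], p_b] (Q f)
        = s_a Q p_b Q f - rho(a+q, b+q) p_b Q s_a Q f,
>>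
    which is [hom_antibracketQ].  As the anchor of s_a is f |-> s_a (Q f), of
    degree a+q, the right-hand side is the commutator of the anchors of s_a
    and p_b.

    The remaining work is to justify the reduction to components.  The
    commutators are defined through the components of their arguments, so one
    needs that the decompositions used are the canonical ones: [part_weight]
    says that the components of a map inherit its behaviour on weights, and
    [anchor_decomposition] that the anchors of the s_a are the components of
    the anchor of s, shifted by q.  With them both sides of the theorem expand
    to the same double sum, in [anchor_antibracket] and [rho_comm_anchor].
    The antibracket comes under [anchor_val], which computes the anchor of any
    graded map that kills weight 0 and lands in weight 0 on the elements
    Q f. *)

Set Implicit Arguments.
Unset Strict Implicit.
Unset Printing Implicit Defensive.

Import GRing.Theory Num.Theory.

Local Open Scope classical_set_scope.
Local Open Scope ring_scope.

(** * Linear maps, cocycles and finite decompositions *)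

Section LinearMaps.
Variables (K : fieldType) (V : lmodType K) (L : V -> V).
Hypothesis linL : linear L.

Lemma linear_fun0 : L 0 = 0.
Proof. by have := linL (-1) 0 0; rewrite scaler0 addr0 scaleN1r addNr. Qed.

Lemma linear_fun_sum (I : Type) (r : seq I) (F : I -> V) :
  L (\sum_(i <- r) F i) = \sum_(i <- r) L (F i).
Proof.
elim: r => [|i r IH]; first by rewrite !big_nil linear_fun0.
by rewrite !big_cons -[F i]scale1r linL IH !scale1r.
Qed.

End LinearMaps.

Lemma cocycleDr (K : fieldType) (G : zmodType) (rho : cocycle K G) a b c :
  rho a (b + c) = rho a b * rho a c.
Proof. by rewrite cocycle_sym cocycleD invfM -!cocycle_sym. Qed.

Section Support.
Variables (K : fieldType) (V : lmodType K) (I : choiceType).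

Definition support_fset (F : I -> V) : {fset I} := fset_set [set i | F i <> 0].

Lemma support_fsetP S v (F : I -> V) i : decomposition S v F ->
  i \notin support_fset F -> F i = 0.
Proof.
by move=> [_ finF _]; rewrite in_fset_set// notin_setE/= => /contrapT.
Qed.

Lemma decomposition_sum S v (F : I -> V) : decomposition S v F ->
  v = \sum_(i <- support_fset F) F i.
Proof.
by move=> dF; case: (dF) => _ _ ->; apply: fsbigTE => i /(support_fsetP dF).
Qed.

Lemma decomposition0 S (F : I -> V) : (forall i, linear_subspace (S i)) ->
  independent S -> decomposition S 0 F -> forall i, F i = 0.
Proof.
move=> SS indS dF i.
have d0 : decomposition S 0 (fun=> 0 : V).
  split=> [j||]; first by case: (SS j).
    by apply: (sub_finite_set _ (finite_set0 I)) => j /=.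
  by rewrite fsbig1.
by rewrite (indS _ _ _ dF d0).
Qed.

End Support.

(** * The commutator in terms of decompositions *)

Section BracketExpansion.
Variables (K : fieldType) (G : zmodType) (V : lmodType K) (S : G -> set V).
Variable rho : cocycle K G.
Hypothesis SS : forall a, linear_subspace (S a).
Hypothesis indS : independent S.
Hypothesis fullS : dirsum S = setT.

(** Uniqueness of decompositions turns the sums over the whole group that
    define the commutator into finite ones; r and u may be any finite sets
    containing the supports, which leaves room for a shift of degrees. *)
Lemma rho_comm_maps_decomposition X Y (F H : G -> V -> V) (r u : {fset G}) :
  decomposition (hom_deg S) X F -> decomposition (hom_deg S) Y H ->
  (forall a, a \notin r -> F a = 0) -> (forall b, b \notin u -> H b = 0) ->
  rho_comm_maps rho S X Y =
  \sum_(a <- r) \sum_(b <- u) (F a \o H b - rho a b *: (H b \o F a)).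
Proof.
move=> dF dH F0 H0; have ind := independent_hom_deg indS fullS.
have XE := componentE ind dF; have YE := componentE ind dH.
have linF a : linear (F a) by case: dF => /(_ a)[].
have linH b : linear (H b) by case: dH => /(_ b)[].
have zl a b : F a = 0 -> F a \o H b - rho a b *: (H b \o F a) = 0.
  move=> ->; apply/funext => v.
  by rewrite !fctE /= (linear_fun0 (linH b)) scaler0 subr0.
have zr a b : H b = 0 -> F a \o H b - rho a b *: (H b \o F a) = 0.
  move=> ->; apply/funext => v.
  by rewrite !fctE /= (linear_fun0 (linF a)) scaler0 subr0.
rewrite /rho_comm_maps /rho_bracket (fsbigTE r) => [|a ar]; last first.
  by apply: fsbig1 => b _; rewrite XE YE zl// F0.
apply: eq_bigr => a _; rewrite (fsbigTE u) => [|b bu]; last first.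
  by rewrite XE YE zr// H0.
by apply: eq_bigr => b _; rewrite XE YE.
Qed.

Lemma hom_deg_comp a b X Y : hom_deg S a X -> hom_deg S b Y ->
  hom_deg S (a + b) (X \o Y).
Proof.
move=> [linX SX] [linY SY]; split=> [c u v|c v Sv] /=; first by rewrite linY linX.
by rewrite -addrA; apply/SX/SY.
Qed.

Lemma hom_deg_rho_comm a b X Y : hom_deg S a X -> hom_deg S b Y ->
  hom_deg S (a + b) (X \o Y - rho a b *: (Y \o X)).
Proof.
move=> SX SY; rewrite [_ \o _ - _]addrC -scaleNr.
have [_] := linear_subspace_hom_deg SS (a + b); apply; last exact: hom_deg_comp.
by rewrite addrC; exact: hom_deg_comp.
Qed.

End BracketExpansion.

(** * Weights and G-components *)

Section WeightComponents.
Variables (K : fieldType) (G : zmodType) (rho : cocycle K G) (A : Qalg1 rho).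
Local Notation Gdeg := (Gdeg A).
Local Notation part := (component (hom_deg Gdeg)).

(** The bihomogeneous decomposition of v is also a decomposition by G-degree
    alone, and the latter is unique. *)
Lemma bihom_component (j : nat) v F c :
  weight A j v -> decomposition Gdeg v F -> bihom A j c (F c).
Proof.
move=> [E [SE finE vE]] dF.
have dE : decomposition Gdeg v E by split=> // a; exact: bihom_Gdeg (SE a).
by rewrite (independent_Gdeg dF dE).
Qed.

Lemma weight_Gdeg_bihom (j : nat) c v : weight A j v -> Gdeg c v -> bihom A j c v.
Proof.
move=> Wv Gv.
have := bihom_component c Wv (decomposition1 (@linear_subspace_Gdeg _ _ _ A) Gv).
by rewrite eqxx.
Qed.

Lemma bihom_weight (j : nat) c v : bihom A j c v -> weight A j v.
Proof.
by apply: (dirsum_in (S := bihom A j)) => a; exact: linear_subspace_bihom.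
Qed.

Lemma part_decomposition T : dirsum (hom_deg Gdeg) T ->
  decomposition (hom_deg Gdeg) T (part^~ T).
Proof.
move=> [F dF]; suff -> : part^~ T = F by [].
apply/funext => a; apply: componentE dF _.
by apply: independent_hom_deg; [exact: independent_Gdeg|exact: dirsum_Gdeg].
Qed.

(** On an element of degree b, the a-component of T is the component of degree
    a + b of the value of T, and a subspace of fixed weight contains the
    G-components of its elements. *)
Lemma part_weight T a (i : nat) (j : int) : dirsum (hom_deg Gdeg) T ->
  (forall f, weight A i f -> weight A j (T f)) ->
  forall f, weight A i f -> weight A j (part a T f).
Proof.
move=> /part_decomposition dT TW f [E [SE finE ->]].
have [/(_ a)[linT _] _ _] := dT.
rewrite (fsbigTE (support_fset E)) => [|b]; last first.
  by rewrite in_fset_set// notin_setE/= => /contrapT.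
rewrite (linear_fun_sum linT); apply: linear_subspace_sum => [|b].
  exact: linear_subspace_weight.
have d := decomposition_eval dT (bihom_Gdeg (SE b)).
have W := TW _ (bihom_weight (SE b)).
case: j {TW} W => n W.
  by have := bihom_component (a + b) W d; rewrite addrK => /bihom_weight.
(* In negative weight the target space is 0. *)
rewrite W in d.
have := decomposition0 (@linear_subspace_Gdeg _ _ _ A) (@independent_Gdeg _ _ _ A) d.
by move=> /(_ (a + b)); rewrite addrK.
Qed.

End WeightComponents.

(** * The grading of the base algebra *)

Section BaseGrading.
Variables (K : fieldType) (G : zmodType) (rho : cocycle K G) (A : Qalg1 rho).
Local Notation deg := (base_deg (A := A)).

Lemma val_base_sum (I : Type) (r : seq I) (F : I -> base_alg A) :
  val (\sum_(i <- r) F i : base A) = \sum_(i <- r) val (F i : base A).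
Proof. by elim/big_ind2: _ => // x1 x2 y1 y2 <- <-. Qed.

Lemma base_weight (f : base_alg A) : weight A 0 (val (f : base A)).
Proof. by apply/asboolP; exact: (valP f). Qed.

Lemma base_decomposition (f : base_alg A) F : decomposition deg f F ->
  decomposition (Gdeg A) (val (f : base A)) (fun a => val (F a : base A)).
Proof.
move=> dF; case: (dF) => SF finF _; split.
- by move=> a; exact: bihom_Gdeg (SF a).
- by apply: sub_finite_set finF => a /= Fa0 F0; apply: Fa0; rewrite F0.
- rewrite (decomposition_sum dF) val_base_sum; apply/esym/fsbigTE => a.
  by move=> /(support_fsetP dF)->.
Qed.

Lemma independent_base_deg : independent deg.
Proof.
move=> f F H /base_decomposition dF /base_decomposition dH.
have FH := independent_Gdeg dF dH.
by apply/funext => a; apply: val_inj; exact: (congr1 (@^~ a) FH).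
Qed.

Lemma dirsum_base_deg : dirsum deg = setT.
Proof.
rewrite -subTset => f _; have [E [SE finE fE]] := base_weight f.
have inE a : in_base (E a) by apply/asboolP; exact: bihom_weight (SE a).
pose F a : base A := Sub (E a) (inE a).
have F0 a : E a = 0 -> F a = 0 by move=> Ea; apply: val_inj.
exists F; split=> //.
  by apply: sub_finite_set finE => a /= Fa0 /F0.
have out a : a \notin support_fset E -> E a = 0.
  by rewrite in_fset_set// notin_setE/= => /contrapT.
rewrite (fsbigTE (support_fset E)) => [|a /out/F0]//.
apply: val_inj; rewrite val_base_sum fE; exact: fsbigTE.
Qed.

End BaseGrading.

(** * The anchor of graded maps and of components of sections *)

Section HomogeneousAnchor.
Variables (K : fieldType) (G : zmodType) (rho : cocycle K G) (A : Qalg1 rho).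
Local Notation q := (Qdeg A).
Local Notation Q := (Qder A).
Local Notation Gdeg := (Gdeg A).
Local Notation bracket := (rho_comm_maps rho Gdeg).
Local Notation part := (component (hom_deg Gdeg)).
Local Notation subG := (@linear_subspace_Gdeg _ _ _ A).
Local Notation indG := (@independent_Gdeg _ _ _ A).
Local Notation fullG := (@dirsum_Gdeg _ _ _ A).

(** The behaviour of a section on the elements at which the proof evaluates it:
    f of weight 0, Q f of weight 1, and their images under Q and under other
    sections, which alternate between these two weights. *)
Definition lowers_weight (T : A -> A) : Prop :=
  (forall f, weight A 0 f -> T f = 0) /\
  (forall f, weight A 1 f -> weight A 0 (T f)).

Lemma Sec_lowers_weight s : Sec A s -> lowers_weight s.
Proof. by move=> Ss; split=> f; [exact: Sec_weight0|exact: Sec_weight1]. Qed.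

Lemma Sec_graded s : Sec A s -> dirsum (hom_deg Gdeg) s.
Proof.
by move=> /Sec_part[hF finF sE]; exists (part^~ s); split=> // a; case: (hF a).
Qed.

Lemma part_kills_weight0 T a : dirsum (hom_deg Gdeg) T ->
  (forall f, weight A 0 f -> T f = 0) ->
  forall f, weight A 0 f -> part a T f = 0.
Proof. by move=> gT T0; exact: (part_weight a (i := 0) (j := -1)). Qed.

Lemma part_lowers_weight T a : dirsum (hom_deg Gdeg) T ->
  lowers_weight T -> lowers_weight (part a T).
Proof.
move=> gT [T0 T1]; split; first exact: part_kills_weight0.
exact: (part_weight a (i := 1) (j := 0)).
Qed.

Lemma Q_hom_deg : hom_deg Gdeg q Q.
Proof. by case: (Qder_homological A) => -[]. Qed.

Lemma Q_linear : linear Q.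
Proof. by case: Q_hom_deg. Qed.

Lemma Q_weight0 f : weight A 0 f -> weight A 1 (Q f).
Proof. by move=> Wf; case: (Qder_weight A) => _ /(_ 0%N _ Wf). Qed.

Lemma Q_squared f : (2%:R : K) != 0 -> Q (Q f) = 0.
Proof.
move=> nz2; have [_ qq] := Qder_homological A.
rewrite (rho_comm_mapsE subG indG rho fullG Q_hom_deg Q_hom_deg) qq scaleN1r opprK.
move=> /(congr1 (fun T => T f)); rewrite !fctE /= -mulr2n -scaler_nat.
by move/eqP; rewrite scaler_eq0 (negbTE nz2) => /eqP.
Qed.

(** [Q, S] for S of degree a. *)
Definition comm_Q (a : G) (S : A -> A) : A -> A := Q \o S - rho q a *: (S \o Q).

Lemma comm_QE a S : hom_deg Gdeg a S -> bracket Q S = comm_Q a S.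
Proof. exact: (rho_comm_mapsE subG indG rho fullG Q_hom_deg). Qed.

Lemma comm_Q_weight0 a S f : (forall g, weight A 0 g -> S g = 0) ->
  weight A 0 f -> comm_Q a S f = - (rho q a *: S (Q f)).
Proof. by move=> S0 Wf; rewrite /comm_Q !fctE /= S0// (linear_fun0 Q_linear) sub0r. Qed.

Lemma rho_anchor_sign a : rho (a + q) q = - rho a q.
Proof. by have [_ qq _] := Qder_homological A; rewrite cocycleD qq mulrN1. Qed.

Lemma rho_anchor_cancel a : rho (a + q) q * rho q a = -1.
Proof. by rewrite rho_anchor_sign (cocycle_sym rho a q) mulNr mulVf// cocycle_neq0. Qed.

(** On weight 0 only the second term of [Q, T_a] = Q T_a - rho(q, a) T_a Q
    survives, and its coefficient is cancelled by the factor rho(a+q, q) in the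
    definition of the anchor. *)
Lemma anchor_val T (f : base_alg A) : dirsum (hom_deg Gdeg) T ->
  (forall g, weight A 0 g -> T g = 0) ->
  weight A 0 (T (Q (val (f : base A)))) ->
  val (anchor T f : base A) = T (Q (val (f : base A))).
Proof.
move=> gT T0 W; have dT := part_decomposition gT.
suff E : (\sum_(a \in [set: G]) rho (a + q) q *: bracket Q (part a T)) (val (f : base A))
    = T (Q (val (f : base A))).
  by rewrite /anchor insubdK E//; exact/asboolP.
have hF a : hom_deg Gdeg a (part a T) by case: dT.
rewrite (fsbigTE (support_fset (part^~ T))) => [|a /(support_fsetP dT) pa].
  rewrite [in RHS](decomposition_sum dT) !fct_sumE; apply: eq_bigr => a _.
  rewrite fctE (comm_QE (hF a)) comm_Q_weight0; first last.
  - exact: base_weight.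
  - exact: part_kills_weight0.
  by rewrite scalerN scalerA rho_anchor_cancel scaleN1r opprK.
rewrite (comm_QE (hF a)) pa /comm_Q; apply/funext => v.
by rewrite !fctE /= (linear_fun0 Q_linear) !scaler0 subr0 scaler0.
Qed.

Lemma Sec_anchor_part s a (f : base_alg A) : Sec A s ->
  val (anchor (part a s) f : base A) = part a s (Q (val (f : base A))).
Proof.
move=> Ss; have gs := Sec_graded Ss.
have [s0 s1] := part_lowers_weight a gs (Sec_lowers_weight Ss).
have [/(_ a) hs _ _] := part_decomposition gs.
apply: anchor_val => //; last by apply: s1; apply: Q_weight0; exact: base_weight.
by apply: dirsum_in hs => b; exact: (linear_subspace_hom_deg subG).
Qed.

(** The degree of the anchor of a section of degree a is a + q, hence the
    shift in the index. *)
Lemma anchor_decomposition s : Sec A s ->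
  decomposition (hom_deg (base_deg (A := A))) (anchor s)
    (fun c => anchor (part (c - q) s)).
Proof.
move=> Ss; have gs := Sec_graded Ss; have ds := part_decomposition gs.
have [hs finS _] := ds.
have z a : part a s = 0 -> anchor (part a s) = 0.
  by move=> pa; apply/funext => f; apply: val_inj; rewrite Sec_anchor_part// pa.
split.
- move=> c; have [linS SS] := hs (c - q); split.
    move=> d u v; apply: val_inj.
    by rewrite Sec_anchor_part//= Q_linear linS !Sec_anchor_part.
  move=> b v Sv; rewrite /base_deg /= Sec_anchor_part//.
  have [_ s1] := part_lowers_weight (c - q) gs (Sec_lowers_weight Ss).
  apply: weight_Gdeg_bihom; first by apply: s1; apply: Q_weight0; exact: base_weight.
  rewrite -[c](subrK q) -addrA addrK; apply: SS.
  by case: Q_hom_deg => _; apply; exact: bihom_Gdeg Sv.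
- apply: sub_finite_set (finite_image (fun a => a + q) finS) => c /= Fc0.
  by exists (c - q); rewrite ?subrK// => F0; apply/Fc0/z.
- rewrite (reindex_fsbigT (fun a => a + q)); last first.
    by exists (fun a => a - q) => a; rewrite ?addrK ?subrK.
  rewrite (fsbigTE (support_fset (part^~ s))) => [|a]; last first.
    by rewrite addrK => /(support_fsetP ds)/z.
  apply/funext => f; apply: val_inj; rewrite fct_sumE val_base_sum anchorE//.
  rewrite [in LHS](decomposition_sum ds) fct_sumE; apply: eq_bigr => a _.
  by rewrite addrK Sec_anchor_part.
Qed.

End HomogeneousAnchor.

(** * The two sides as double sums *)

Section DerivedBracketExpansion.
Variables (K : fieldType) (G : zmodType) (rho : cocycle K G) (A : Qalg1 rho).
Local Notation q := (Qdeg A).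
Local Notation Q := (Qder A).
Local Notation Gdeg := (Gdeg A).
Local Notation part := (component (hom_deg Gdeg)).
Local Notation subG := (@linear_subspace_Gdeg _ _ _ A).
Local Notation indG := (@independent_Gdeg _ _ _ A).
Local Notation fullG := (@dirsum_Gdeg _ _ _ A).

(** The derived antibracket of S of degree a and P of degree b. *)
Definition hom_antibracket (a b : G) (S P : A -> A) : A -> A :=
  rho (a + q) q *: (comm_Q a S \o P - rho (q + a) b *: (P \o comm_Q a S)).

Lemma antibracket_expansion s p :
  dirsum (hom_deg Gdeg) s -> dirsum (hom_deg Gdeg) p ->
  antibracket s p =
  \sum_(a <- support_fset (part^~ s)) \sum_(b <- support_fset (part^~ p))
    hom_antibracket a b (part a s) (part b p).
Proof.
move=> /part_decomposition ds /part_decomposition dp.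
have [hs _ _] := ds; have [hp _ _] := dp.
have qE a : rho_comm_maps rho Gdeg (comm_Q a (part a s)) p =
    \sum_(b <- support_fset (part^~ p))
      (comm_Q a (part a s) \o part b p -
       rho (q + a) b *: (part b p \o comm_Q a (part a s))).
  have hX := hom_deg_rho_comm rho subG (Q_hom_deg A) (hs a).
  have d1 := decomposition1 (linear_subspace_hom_deg subG) hX.
  rewrite (rho_comm_maps_decomposition rho indG fullG d1 dp
    (r := [fset (q + a)%R]%fset) (u := support_fset (part^~ p))).
  - by rewrite big_seq_fset1 eqxx.
  - by move=> c; rewrite in_fset1 => /negbTE->.
  - by move=> b; exact: support_fsetP dp.
rewrite /antibracket (fsbigTE (support_fset (part^~ s))) => [|a /(support_fsetP ds) sa].
  apply: eq_bigr => a _; rewrite (comm_QE (hs a)) qE scaler_sumr.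
  exact: eq_bigr.
rewrite (comm_QE (hs a)) qE big1 ?scaler0// => b _; apply/funext => v.
have [linp _] := hp b.
rewrite /comm_Q sa !fctE /= (linear_fun0 (@Q_linear _ _ _ A)) scaler0 subr0.
by rewrite (linear_fun0 linp) scaler0 subr0.
Qed.

Lemma hom_antibracket_hom_deg a b S P :
  hom_deg Gdeg a S -> hom_deg Gdeg b P ->
  hom_deg Gdeg (q + a + b) (hom_antibracket a b S P).
Proof.
move=> hS hP; apply: linear_subspaceZ; first exact: (linear_subspace_hom_deg subG).
apply: (hom_deg_rho_comm rho subG) => //.
exact: (hom_deg_rho_comm rho subG (Q_hom_deg A)).
Qed.

(** P kills f, and it also kills [Q, S] f, which is a multiple of S (Q f) and
    so has weight 0. *)
Lemma hom_antibracket_weight0 a b S P f : linear S -> linear P ->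
  lowers_weight S -> lowers_weight P ->
  weight A 0 f -> hom_antibracket a b S P f = 0.
Proof.
move=> linS linP [S0 S1] [P0 P1] Wf.
have W : weight A 0 (comm_Q a S f).
  rewrite comm_Q_weight0// -scaleNr; apply: linear_subspaceZ; last exact/S1/Q_weight0.
  exact: linear_subspace_weight.
rewrite /hom_antibracket !fctE /= (P0 _ Wf) (P0 _ W) /comm_Q !fctE /=.
by rewrite !(linear_fun0 linS, linear_fun0 (@Q_linear _ _ _ A)) !(scaler0, subr0).
Qed.

(** The heart of the matter.  Since Q (Q f) = 0, applying [Q, S] to Q f gives
    Q (S (Q f)); since P (Q f) has weight 0, applying [Q, S] to it gives
    - rho(q, a) S (Q (P (Q f))). *)
Lemma hom_antibracketQ a b S P f : (2%:R : K) != 0 -> linear S -> linear P ->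
  lowers_weight S -> lowers_weight P -> weight A 0 f ->
  hom_antibracket a b S P (Q f) =
  S (Q (P (Q f))) - rho (a + q) (b + q) *: P (Q (S (Q f))).
Proof.
move=> nz2 linS linP [S0 S1] [P0 P1] Wf.
have WP : weight A 0 (P (Q f)) by exact/P1/Q_weight0.
have SQQ : comm_Q a S (Q f) = Q (S (Q f)).
  by rewrite /comm_Q !fctE /= Q_squared// (linear_fun0 linS) scaler0 subr0.
rewrite /hom_antibracket !fctE /= SQQ comm_Q_weight0//.
rewrite scalerBr scalerN !scalerA rho_anchor_cancel scaleN1r opprK.
by rewrite (addrC q a) cocycleDr mulrC.
Qed.

Definition anchor_commutator_expansion (s p : A -> A) (f : A) : A :=
  \sum_(a <- support_fset (part^~ s)) \sum_(b <- support_fset (part^~ p))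
    (part a s (Q (part b p (Q f))) -
     rho (a + q) (b + q) *: part b p (Q (part a s (Q f)))).

Lemma anchor_antibracket s p (f : base_alg A) : (2%:R : K) != 0 ->
  Sec A s -> Sec A p ->
  val (anchor (antibracket s p) f : base A) =
  anchor_commutator_expansion s p (val (f : base A)).
Proof.
move=> nz2 Ss Sp; have gs := Sec_graded Ss; have gp := Sec_graded Sp.
have [hs _ _] := part_decomposition gs; have [hp _ _] := part_decomposition gp.
have ls a := part_lowers_weight a gs (Sec_lowers_weight Ss).
have lp b := part_lowers_weight b gp (Sec_lowers_weight Sp).
have linS a : linear (part a s) by case: (hs a).
have linP b : linear (part b p) by case: (hp b).
have Wf := base_weight f.
have E : antibracket s p (Q (val (f : base A))) =
  anchor_commutator_expansion s p (val (f : base A)).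
  rewrite antibracket_expansion// fct_sumE; apply: eq_bigr => a _.
  by rewrite fct_sumE; apply: eq_bigr => b _; rewrite hom_antibracketQ.
rewrite -E; apply: anchor_val.
- have subH := linear_subspace_hom_deg subG.
  rewrite antibracket_expansion//.
  apply: linear_subspace_sum => [|a]; first exact: linear_subspace_dirsum.
  apply: linear_subspace_sum => [|b]; first exact: linear_subspace_dirsum.
  by apply: dirsum_in (hom_antibracket_hom_deg (hs a) (hp b)).
- move=> g Wg; rewrite antibracket_expansion// fct_sumE big1// => a _.
  by rewrite fct_sumE big1// => b _; rewrite hom_antibracket_weight0.
- rewrite E /anchor_commutator_expansion; have W0 := linear_subspace_weight A 0.
  apply: linear_subspace_sum => // a; apply: linear_subspace_sum => // b.
  rewrite addrC -scaleNr; case: (W0) => _; apply.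
    by apply: (lp b).2; apply: Q_weight0; apply: (ls a).2; exact: Q_weight0.
  by apply: (ls a).2; apply: Q_weight0; apply: (lp b).2; exact: Q_weight0.
Qed.

Lemma rho_comm_anchor s p (f : base_alg A) : Sec A s -> Sec A p ->
  val (rho_comm_maps rho (base_deg (A := A)) (anchor s) (anchor p) f : base A) =
  anchor_commutator_expansion s p (val (f : base A)).
Proof.
move=> Ss Sp.
pose shift_support T := [fset (a + q)%R | a in support_fset (part^~ T)]%fset.
have out T : Sec A T -> forall c, c \notin shift_support T ->
    anchor (part (c - q) T) = 0.
  move=> ST c cT; have /part_decomposition dT := Sec_graded ST.
  have pc : part (c - q) T = 0.
    apply: (support_fsetP dT); apply: contra cT => cT.
    by apply/imfsetP; exists (c - q) => //=; rewrite subrK.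
  by apply/funext => g; apply: val_inj; rewrite Sec_anchor_part// pc.
rewrite (rho_comm_maps_decomposition rho (@independent_base_deg _ _ _ A)
  (@dirsum_base_deg _ _ _ A) (anchor_decomposition Ss)
  (anchor_decomposition Sp) (out s Ss) (out p Sp)).
have injq : injective (fun a : G => a + q) by exact: addIr.
rewrite big_imfset /=; last by move=> a b _ _; exact: injq.
rewrite fct_sumE val_base_sum; apply: eq_bigr => a _.
rewrite big_imfset /=; last by move=> c b _ _; exact: injq.
rewrite fct_sumE val_base_sum; apply: eq_bigr => b _.
rewrite !addrK !fctE /=.
by rewrite !Sec_anchor_part.
Qed.

End DerivedBracketExpansion.

Theorem proposition4p7 (R : realType) (k : ground_field) (G : zmodType)
    (rho : cocycle (scalars R k) G) (A : Qalg1 rho) (s p : A -> A)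
    (hs : Sec A s) (hp : Sec A p) :
  anchor (antibracket s p)
  = rho_comm_maps rho (base_deg (A := A)) (anchor s) (anchor p).
Proof.
apply/funext => f; apply: val_inj; rewrite rho_comm_anchor// anchor_antibracket//.
by rewrite pnatr_eq0.
Qed.
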